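(* Let $0<r_1<r_2<\cdots<r_s$ and $0<l_1<l_2<\cdots<l_t$ be positive integers and let $R=\{-l_t,\dots,-l_2,-l_1,r_1,r_2,\dots,r_s\}$. Then $$\mathsf{cap}(\mathbb Z_R)\le 1-\max\bigl\{\mathcal R(\{l_1,\dots,l_t\}),\ \mathcal R(\{r_1,\dots,r_s\})\bigr\}.$$
   Context: Difference-avoiding sets: for a set $B$ of positive integers, a set $A\subseteq\mathbb Z$ is called $B$-avoiding if $|a_1-a_2|\notin B$ for all $a_1,a_2\in A$. Let $a_n$ be the size of the largest $B$-avoiding subset of $[n]=\{0,1,\dots,n-1\}$ and define $\mathcal R(B)=\limsup_{n\to\infty}a_n/n$. Recoverable systems: fix a finite alphabet $Q$ of size $q\ge 2$. For a finite set $R\subset\mathbb Z\setminus\{0\}$, an $R$-recoverable system on $\mathbb Z$ is a nonempty set $X\subseteq Q^{\mathbb Z}$ such that for every $i\in\mathbb Z$ there is a function $f_i:Q^{|R|}\to Q$ (which may depend on $i$) with $x_i=f_i(x_{i+R})$ for all $x\in X$, where $x_{i+R}$ is the restriction of $x$ to $i+R=\{i+j:j\in R\}$. Its rate is $\limsup_{n\to\infty}\frac1n\log_q|B_n(X)|$, where $B_n(X)=\{x_{[n]}:x\in X\}$. The capacity $\mathsf{cap}(\mathbb Z_R)$ is the supremum of the rates over all $R$-recoverable systems $X\subseteq Q^{\mathbb Z}$. *)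

(* Defs.v *)
From HB Require Import structures.
From mathcomp Require Export all_boot all_order all_algebra finmap.
From mathcomp Require Export all_classical all_reals all_analysis.

Set Implicit Arguments.
Unset Strict Implicit.
Unset Printing Implicit Defensive.

Import Order.TTheory GRing.Theory Num.Theory.

Local Open Scope classical_set_scope.
Local Open Scope ring_scope.

(** Limits superior and suprema are taken in [\bar R], so that they are never
    default values; the sequences involved have values in [0, 1], their 0-th
    terms being 0 because division by zero gives 0. *)

Definition avoiding (B : set nat) (A : set int) : Prop :=
  forall a1 a2, A a1 -> A a2 -> ~ B `|a1 - a2|%N.

Definition max_avoiding (B : set nat) (n : nat) : nat :=
  \max_(A : {set 'I_n} |
        `[< avoiding B [set (nat_of_ord i)%:Z | i in [set` A]] >]) #|A|.

Definition avoiding_density (R : realType) (B : set nat) : \bar R :=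
  limn_esup (fun n => ((max_avoiding B n)%:R / n%:R : R)%:E).

(** The set D of offsets is the set called R in the literature, meant to be
    used when 0 is not in D; elements of [{ffun D -> Q}] are the elements of
    Q^|D|, with coordinates indexed by D itself. *)

Definition window (Q : finType) (D : {fset int}) (x : int -> Q) (i : int) :
    {ffun D -> Q} :=
  [ffun j : D => x (i + fsval j)].

Definition recoverable (Q : finType) (D : {fset int}) (X : set (int -> Q)) :
    Prop :=
  X !=set0 /\
  forall i : int, exists f : {ffun D -> Q} -> Q,
    forall x, X x -> x i = f (window D x i).

Definition blocks (Q : finType) (X : set (int -> Q)) (n : nat) :
    set {ffun 'I_n -> Q} :=
  [set [ffun i : 'I_n => x (nat_of_ord i)%:Z] | x in X].
Arguments blocks {Q} X n.

Definition rate (R : realType) (Q : finType) (X : set (int -> Q)) : \bar R :=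
  limn_esup (fun n =>
    (ln (#|` fset_set (blocks X n)|%:R) / ln (#|Q|%:R) / n%:R : R)%:E).

Definition capacity (R : realType) (Q : finType) (D : {fset int}) : \bar R :=
  ereal_sup [set rate R X | X in recoverable (Q := Q) D].

(** {-l | l in ls} together with {r | r in rs} *)
Definition offsets (ls rs : seq nat) : {fset int} :=
  ([fset - l%:Z | l in ls] `|` [fset r%:Z | r in rs])%fset.

(* Main.v *)
(** If [A] is a subset of [0, n[ avoiding all the differences l_j, then a word
    of a recoverable system is determined on [0, n[ by its letters outside [A]
    together with boundedly many letters at either end: reading from right to
    left, the letter at i in [A] is a function of letters at i - l_j, which are
    never in [A], and at i + r_j, which are already known.  Hence
    |B_n(X)| <= q^(n - a_n + O(1)).  As a_n is subadditive, a_n / n is at least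
    its limsup for every n.  For the r_j one reads from left to right. *)

Require Import Defs.
From mathcomp Require Import zify.

Set Implicit Arguments.
Unset Strict Implicit.
Unset Printing Implicit Defensive.

Import Order.TTheory GRing.Theory Num.Theory.

Local Open Scope classical_set_scope.
Local Open Scope ring_scope.

(** Boundary effects cost [d / n], which drops below any [e > 0] once [n] exceeds [|d| / e]; the
    limsup is at most the supremum over that tail. *)
Lemma limn_esup_le_harmonic (R : realType) (u : nat -> R) (c d : R) :
  (forall n, (0 < n)%N -> u n <= c + d / n%:R) ->
  (limn_esup (fun n => (u n)%:E) <= c%:E)%E.
Proof.
move=> u_le; apply/lee_addgt0Pr => e e_gt0.
pose N := (Num.truncn (`|d| / e)).+1.
have N_gt : `|d| / e < N%:R by rewrite /N truncnS_gt.
apply: le_trans (_ : ereal_sup ((fun n => (u n)%:E) @` [set n | (N <= n)%N]) <= _)%E.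
  by apply: ereal_inf_lbound; exists [set n | (N <= n)%N] => //; exists N.
apply: ge_ereal_sup => _ [n /= Nn <-].
have n_gt0 : (0 < n)%N by apply: leq_trans Nn.
rewrite -EFinD lee_fin (le_trans (u_le _ n_gt0)) // lerD2l.
rewrite ler_pdivrMr ?ltr0n // (le_trans (ler_norm d)) // mulrC -ler_pdivrMr //.
by rewrite (le_trans (ltW N_gt)) // ler_nat.
Qed.

Definition avoiding_ord (B : set nat) (n : nat) (A : {set 'I_n}) : Prop :=
  forall i j, i \in A -> j \in A -> ~ B `|(i : nat)%:Z - (j : nat)%:Z|%N.

Lemma avoiding_ordP (B : set nat) (n : nat) (A : {set 'I_n}) :
  avoiding B [set (nat_of_ord i)%:Z | i in [set` A]] <-> avoiding_ord B A.
Proof.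
split=> [hA i j iA jA | hA _ _ [i /= iA <-] [j /= jA <-]]; last exact: hA.
by apply: hA; [exists i | exists j].
Qed.

Lemma max_avoiding_ge (B : set nat) (n : nat) (A : {set 'I_n}) :
  avoiding_ord B A -> (#|A| <= max_avoiding B n)%N.
Proof.
by move=> /avoiding_ordP hA; apply: leq_bigmax_cond; apply/asboolP.
Qed.

Lemma max_avoiding_attained (B : set nat) (n : nat) :
  exists2 A : {set 'I_n}, avoiding_ord B A & #|A| = max_avoiding B n.
Proof.
(* The empty set qualifies, so the maximum runs over a nonempty family and has a maximizer. *)
have : `[< avoiding B [set (nat_of_ord i)%:Z | i in [set` (finset.set0 : {set 'I_n})]] >].
  by apply/asboolP/avoiding_ordP => i j; rewrite inE.
move=> P0; rewrite /max_avoiding (bigop.bigmax_eq_arg finset.set0) //.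
by case: arg_maxnP => // A /asboolP/avoiding_ordP hA _; exists A.
Qed.

Lemma max_avoiding_le (B : set nat) (n : nat) : (max_avoiding B n <= n)%N.
Proof. by apply/bigmax_leqP => A _; rewrite -[leqRHS]card_ord max_card. Qed.

(** Cut [A] at [m] and shift the upper part down by [m]: differences are translation invariant, so
    both pieces still avoid [B]. *)
Lemma max_avoidingD (B : set nat) (m n : nat) :
  (max_avoiding B (m + n) <= max_avoiding B m + max_avoiding B n)%N.
Proof.
apply/bigmax_leqP => A /asboolP/avoiding_ordP hA.
have -> : #|A| = (#|@lshift m n @^-1: A| + #|@rshift m n @^-1: A|)%N.
  rewrite -!sum1_card big_split_ord /=.
  by congr addn; apply: eq_bigl => i; rewrite inE.
apply: leq_add; apply: max_avoiding_ge => i j; rewrite !inE => iA jA.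
  exact: hA iA jA.
have := hA _ _ iA jA; rewrite /=; congr (~ B _); lia.
Qed.

Lemma max_avoidingM (B : set nat) (k n : nat) :
  (max_avoiding B (k * n) <= k * max_avoiding B n)%N.
Proof.
elim: k => [|k IHk]; first exact: max_avoiding_le.
by rewrite !mulSn (leq_trans (max_avoidingD _ _ _)) // leq_add2l.
Qed.

(** Fekete's argument: division of [m] by [n] and subadditivity give a_m <= (m %/ n) a_n + n, an
    error of [n / m] after dividing by [m]. *)
Lemma avoiding_density_le (R : realType) (B : set nat) (n : nat) :
  (0 < n)%N ->
  (avoiding_density R B <= ((max_avoiding B n)%:R / n%:R : R)%:E)%E.
Proof.
move=> n_gt0; apply: (@limn_esup_le_harmonic _ _ _ n%:R) => m m_gt0.
rewrite ler_pdivrMr ?ltr0n // mulrDl divfK ?pnatr_eq0 -?lt0n //.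
apply: le_trans (_ : ((m %/ n) * max_avoiding B n + n)%:R <= _).
  rewrite ler_nat {1}(divn_eq m n) (leq_trans (max_avoidingD _ _ _)) //.
  by rewrite leq_add ?max_avoidingM // (leq_trans (max_avoiding_le _ _)) // ltnW ?ltn_pmod.
rewrite natrD lerD2r mulrAC ler_pdivlMr ?ltr0n // -!natrM ler_nat.
by rewrite mulnAC mulnC leq_mul2l leq_divM orbT.
Qed.

(** Finiteness turns the extended-real difference [1 - avoiding_density R B] into a real one. *)
Lemma avoiding_density_fin (R : realType) (B : set nat) :
  exists rho : R, avoiding_density R B = rho%:E.
Proof.
have : (avoiding_density R B <= 1%:E)%E.
  apply: (@limn_esup_le_harmonic _ _ _ 0) => n n_gt0.
  by rewrite mul0r addr0 ler_pdivrMr ?ltr0n // mul1r ler_nat max_avoiding_le.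
have : (0 <= avoiding_density R B)%E.
  by apply: limf_esup_ge0 => // n; rewrite lee_fin divr_ge0.
by case: (avoiding_density R B) => // rho _ _; exists rho.
Qed.

(* The letters in [A] are reconstructed in increasing order of [mu]. *)
Lemma recoverable_determined (Q : finType) (D : {fset int}) (X : set (int -> Q))
    (K A : set int) (mu : int -> nat) (x y : int -> Q) :
  recoverable D X -> X x -> X y ->
  (forall i, K i -> x i = y i) ->
  (forall i j, A i -> j \in D ->
     K (i + j) \/ A (i + j) /\ (mu (i + j)%R < mu i)%N) ->
  forall i, A i -> x i = y i.
Proof.
move=> [_ recX] Xx Xy eqK step i.
have [m] := ubnP (mu i); elim: m i => // m IHm i mu_i Ai.
have [f fX] := recX i; rewrite (fX x Xx) (fX y Xy); congr f.
apply/ffunP => j; rewrite !ffunE.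
have [Kij | [Aij lt_mu]] := step i _ Ai (fsvalP j); first exact: eqK.
by apply: IHm => //; apply: leq_trans lt_mu _.
Qed.

(** Choose for each block a word of [X] extending it and read that word at the positions [p]; the
    hypothesis makes this map into Q^T injective. *)
Lemma card_blocks_le (Q : finType) (X : set (int -> Q)) (n : nat)
    (T : finType) (p : T -> int) :
  (forall x y, X x -> X y -> (forall t, x (p t) = y (p t)) ->
     forall i, (i < n)%N -> x i%:Z = y i%:Z) ->
  (#|` fset_set (blocks X n)| <= #|Q| ^ #|T|)%N.
Proof.
move=> det.
have ext (b : fset_set (blocks X n)) :
    exists2 x, X x & [ffun i : 'I_n => x (nat_of_ord i)%:Z] = fsval b.
  have := fsvalP b; rewrite in_fset_set; last exact: finite_finset.
  by rewrite inE => -[x Xx <-]; exists x.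
pose lift_block b := sval (cid2 (ext b)).
have lift_blockP b : X (lift_block b) /\
    [ffun i : 'I_n => lift_block b (nat_of_ord i)%:Z] = fsval b.
  by rewrite /lift_block; case: cid2.
rewrite cardfE -card_ffun.
apply: (@leq_card _ _ (fun b => [ffun t => lift_block b (p t)])).
move=> b c /ffunP eq_bc; apply: val_inj => /=.
have [[Xb <-] [Xc <-]] := (lift_blockP b, lift_blockP c).
apply/ffunP => i; rewrite !ffunE; apply: det => // t.
by have := eq_bc t; rewrite !ffunE.
Qed.

Lemma card_blocks_recoverable (Q : finType) (D : {fset int})
    (X : set (int -> Q)) (n M : nat) (A : {set 'I_n}) (mu : int -> nat) :
  recoverable D X ->
  (forall j, j \in D -> (`|j| <= M)%N) ->
  (forall (i k : 'I_n), i \in A -> k \in A ->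
     (k : nat)%:Z - (i : nat)%:Z \in D -> (mu (k : nat)%:Z < mu (i : nat)%:Z)%N) ->
  (#|` fset_set (blocks X n)| <= #|Q| ^ (n - #|A| + 2 * M))%N.
Proof.
move=> recX leM mono.
(* The last two summands index the margins [-M, 0[ and [n, n + M[. *)
pose T : finType := ({i | i \in ~: A} + ('I_M + 'I_M))%type.
pose p (t : T) : int := match t with
  | inl i => (val i : nat)%:Z
  | inr (inl a) => - a.+1%:Z
  | inr (inr b) => (n + b)%:Z end.
have -> : (n - #|A| + 2 * M = #|T|)%N.
  have cardC : #|{: {i | i \in ~: A}}| = #|~: A| by rewrite card_sig; apply: eq_card.
  by rewrite !card_sum cardC !card_ord addnn mul2n (cardsCs (~: A)) finset.setCK card_ord.
apply: (@card_blocks_le _ _ _ _ p) => x y Xx Xy eq_p i i_lt.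
pose AZ : set int := [set (nat_of_ord k)%:Z | k in [set` A]].
have [iA | iA] := boolP (Ordinal i_lt \in A); last first.
  have iA' : Ordinal i_lt \in ~: A by rewrite inE.
  exact: (eq_p (inl (Sub (Ordinal i_lt) iA'))).
apply: (@recoverable_determined _ D X (range p) AZ mu) => //; last first.
- by exists (Ordinal i_lt).
- move=> _ j [k /= kA <-] jD.
  have : j = (k%:Z + j) - k%:Z by rewrite addrAC subrr add0r.
  have : - M%:Z <= k%:Z + j < (n + M)%N%:Z by have := leM j jD; have := ltn_ord k; lia.
  (* The position [z] that the letter at [k] depends on is in the left margin, in the right margin,
     in [0, n[ outside [A] (all three known), or in [A] with smaller [mu]. *)
  move: (k%:Z + j) => z /andP[z_ge z_lt] jE; rewrite {j}jE in jD.
  case: (ltrP z 0) => [z_lt0 | z_ge0].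
    left; have a_lt : (`|z|.-1 < M)%N by lia.
    by exists (inr (inl (Ordinal a_lt))) => //=; lia.
  case: (ltrP z n%:Z) => [z_ltn | z_gen]; last first.
    left; have b_lt : (`|z| - n < M)%N by lia.
    by exists (inr (inr (Ordinal b_lt))) => //=; lia.
  have h_lt : (`|z| < n)%N by lia.
  have zE : z = (Ordinal h_lt : nat)%:Z by rewrite /=; lia.
  rewrite zE in jD *.
  have [hA | hA] := boolP (Ordinal h_lt \in A).
    by right; split; [exists (Ordinal h_lt) | apply: mono].
  have hA' : Ordinal h_lt \in ~: A by rewrite inE.
  by left; exists (inl (Sub (Ordinal h_lt) hA')).
- by move=> _ [t _ <-].
Qed.

(** The two margins of width [M] contribute only [2 * M / n] to the rate. The order [mu] may depend
    on [n], since reading from the right starts at the end of [0, n[. *)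
Lemma rate_le (R : realType) (Q : finType) (D : {fset int})
    (X : set (int -> Q)) (B : set nat) (mu : nat -> int -> nat) :
  (2 <= #|Q|)%N -> recoverable D X ->
  (forall n (A : {set 'I_n}), avoiding_ord B A ->
     forall i k : 'I_n, i \in A -> k \in A -> (k : nat)%:Z - (i : nat)%:Z \in D ->
       (mu n (k : nat)%:Z < mu n (i : nat)%:Z)%N) ->
  (rate R X <= 1 - avoiding_density R B)%E.
Proof.
move=> Q_ge2 recX mono; have [rho rhoE] := avoiding_density_fin R B.
pose M := (\max_(j <- D) `|j|)%N.
have leM j : j \in D -> (`|j| <= M)%N by move=> jD; apply: leq_bigmax_seq.
rewrite rhoE; apply: (@limn_esup_le_harmonic _ _ _ (2 * M)%:R) => n n_gt0.
have lnQ_gt0 : 0 < ln (#|Q|%:R : R) by rewrite ln_gt0 // ltr1n.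
have nR_gt0 : 0 < n%:R :> R by rewrite ltr0n.
have [A hA cardA] := max_avoiding_attained B n.
have := card_blocks_recoverable recX leM (mono n A hA); rewrite cardA => card_le.
have lnN : ln (#|` fset_set (blocks X n)|%:R : R) <=
    (n - max_avoiding B n + 2 * M)%:R * ln #|Q|%:R.
  (* For a zero count, [ln 0] is 0 by convention. *)
  have [-> | N_gt0] := posnP #|` fset_set (blocks X n)|.
    by rewrite ln0 // mulr_ge0 // ltW.
  rewrite mulr_natl -lnXn ?ltr0n ?(ltnW Q_ge2) // -natrX.
  by rewrite ler_ln ?ler_nat // posrE ltr0n // expn_gt0 (ltnW Q_ge2).
(* This is needed for every positive [n], not just along a subsequence; subadditivity provides
   it. *)
have rho_le : rho * n%:R <= (max_avoiding B n)%:R.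
  by have := avoiding_density_le R B n_gt0; rewrite rhoE lee_fin ler_pdivlMr.
rewrite ler_pdivrMr // ler_pdivrMr // (le_trans lnN) // ler_pM2r //.
rewrite natrD natrB ?max_avoiding_le // mulrDl divfK ?gt_eqF // lerD2r.
by rewrite mulrBl mul1r lerD2l lerN2.
Qed.

Lemma offsetsP (ls rs : seq nat) (j : int) :
  j \in offsets ls rs ->
  (exists2 l, l \in ls & j = - l%:Z) \/ (exists2 r, r \in rs & j = r%:Z).
Proof.
by rewrite in_fsetU => /orP[] /imfsetP[m /= ms ->]; [left | right]; exists m.
Qed.

Lemma path_ltn0_gt0 (s : seq nat) : path ltn 0%N s -> forall m, m \in s -> (0 < m)%N.
Proof. by move=> /(order_path_min ltn_trans)/allP. Qed.

(* [path ltn 0 ls] says 0 < l_1 < l_2 < ... < l_t for ls = [:: l_1; ...; l_t]. *)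
Theorem proposition4p4 (R : realType) (Q : finType) (ls rs : seq nat) :
  (2 <= #|Q|)%N ->
  path ltn 0%N ls ->
  path ltn 0%N rs ->
  (capacity R Q (offsets ls rs) <=
   1 - maxe (avoiding_density R [set` ls]) (avoiding_density R [set` rs]))%E.
Proof.
move=> Q_ge2 /path_ltn0_gt0 ls_gt0 /path_ltn0_gt0 rs_gt0.
apply: ge_ereal_sup => _ [X recX <-].
have [_|_] := leP (avoiding_density R [set` ls]).
(* Here the maximum is the density for [rs]: [A] avoids every [r], and an offset [-l] moves left, so
   letters are recovered from left to right. *)
- apply: (@rate_le _ _ _ _ _ (fun _ z => `|z|%N) Q_ge2 recX) => n A hA i k iA kA.
  case/offsetsP => [[l /ls_gt0 l_gt0 klE] | [r rrs krE]]; first lia.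
  by case: (hA k i kA iA); rewrite krE.
(* Mirror case, from right to left by distance to [n]; positions in [A] are below [n], so the
   truncated subtraction is strictly decreasing there. *)
- apply: (@rate_le _ _ _ _ _ (fun n z => n - `|z|)%N Q_ge2 recX) => n A hA i k iA kA.
  case/offsetsP => [[l lls klE] | [r /rs_gt0 r_gt0 krE]].
    by case: (hA k i kA iA); rewrite klE abszN.
  by have := ltn_ord k; lia.
Qed.
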